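(* Let $G$ be a locally compact Hausdorff topological group, $\mathbb{K}\in\{\mathbb{R},\mathbb{C}\}$, and suppose that the Continuous Frame Hypothesis (stated in the context) holds. Then every continuous partial cotranslation $W:G\times G\to\mathcal{M}_d(\mathbb{K})$ is continuously conjugated to a partial cotranslation whose projector of the units space is constant and orthogonal. Moreover, if the projector of the units space of $W$ and its complement are uniformly bounded, i.e. there exists $M\geq1$ such that $\sup_{g\in G}\{\|W(g,e)\|,\|\mathrm{Id}-W(g,e)\|\}<M$, then $W$ is continuously and boundedly conjugated (by one and the same conjugation) to a partial cotranslation whose projector of the units space is constant and orthogonal.
   Context: $e$ is the unit of $G$; $\mathcal{M}_d(\mathbb{K})$ is the space of $d\times d$ matrices over $\mathbb{K}$, with the operator norm induced by the Euclidean norm on $\mathbb{K}^d$; $GL_d(\mathbb{K})$ is the general linear group; $G\times G$ has the product topology. Continuous Frame Hypothesis (a conjecture, assumed here): let $\{\xi_1,\dots,\xi_d\}$ be the canonical basis of $\mathbb{K}^d$. If $\mathrm{P}:G\to\mathcal{M}_d(\mathbb{K})$ is continuous and $\mathrm{P}(g)$ is idempotent for every $g\in G$, then for every $g\in G$ there exist an orthonormal basis $\{\eta_1^g,\dots,\eta_n^g\}$ of $\mathrm{im}\,\mathrm{P}(g)$ (with $n=\mathrm{rank}\,\mathrm{P}(g)$) and an orthonormal basis $\{\eta_{n+1}^g,\dots,\eta_d^g\}$ of $\ker\mathrm{P}(g)$ such that the map $T:G\to GL_d(\mathbb{K})$ defined by $T(g)\xi_i=\eta_i^g$ is continuous. A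 function $W:G\times G\to\mathcal{M}_d(\mathbb{K})$ is a partial cotranslation if $W(g,kh)=W(hg,k)W(g,h)$ for all $g,h,k\in G$. The rank of $W(g,h)$ does not depend on $(g,h)$, and $\mathrm{rank}\,W$ denotes this common value. The projector of the units space of $W$ is $g\mapsto W(g,e)$; it is constant and orthogonal if $W(g,e)=\begin{pmatrix}\mathrm{Id}_{\mathrm{rank}\,W}&0\\0&0\end{pmatrix}$ for all $g\in G$. Partial cotranslations $W,V$ are conjugated if there is a map (a conjugation) $T:G\to GL_d(\mathbb{K})$ such that $T(hg)V(g,h)=W(g,h)T(g)$ for all $g,h\in G$; they are continuously conjugated if $T$, $W$ and $V$ are continuous; boundedly conjugated if $\sup_{g\in G}\{\|T(g)\|,\|T(g)^{-1}\|\}<\infty$. *)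

(* Defs.v *)
From HB Require Import structures.
From mathcomp Require Import all_boot all_order all_algebra.
From mathcomp Require Import complex.
From mathcomp Require Import all_classical all_reals all_analysis.
Import Order.TTheory GRing.Theory Num.Theory.
Import numFieldNormedType.Exports.

Set Implicit Arguments.
Unset Strict Implicit.
Unset Printing Implicit Defensive.

Local Open Scope classical_set_scope.
Local Open Scope ring_scope.

HB.mixin Record Group_isTopological G & Topological G & Group G := {
  mulg_continuous : continuous (fun p : G * G => (p.1 * p.2)%g);
  invg_continuous : continuous (fun g : G => g^-1%g)
}.

#[short(type="topGroupType")]
HB.structure Definition TopologicalGroup :=
  {G of Topological G & Group G & Group_isTopological G}.

(* The two cases K = R and K = C.  Both fields are seen as numFieldTypes, which
   gives K and its matrix spaces their usual topologies. *)
Variant scalar_kind := RealScalars | ComplexScalars.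

Definition scalar_field (R : realType) (k : scalar_kind) : numFieldType :=
  match k with
  | RealScalars => (R : numFieldType)
  | ComplexScalars => (R[i] : numFieldType)
  end.

Definition conj_scalar (R : realType) (k : scalar_kind) :
    scalar_field R k -> scalar_field R k :=
  match k return scalar_field R k -> scalar_field R k with
  | RealScalars => fun x => x
  | ComplexScalars => fun z : R[i] => conjc z
  end.

(* The norm `|x| takes its values in K itself, hence this R-valued
   modulus. *)
Definition modulus (R : realType) (k : scalar_kind) : scalar_field R k -> R :=
  match k return scalar_field R k -> R with
  | RealScalars => fun x : R => `|x|
  | ComplexScalars => fun z : R[i] => ComplexField.Normc.normc z
  end.

Section Euclidean.
Variables (R : realType) (k : scalar_kind) (d : nat).
Local Notation K := (scalar_field R k).

Definition inner (x y : 'cV[K]_d) : K :=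
  \sum_(i < d) x i ord0 * conj_scalar (y i ord0).

Definition enorm (x : 'cV[K]_d) : R :=
  Num.sqrt (\sum_(i < d) modulus (x i ord0) ^+ 2).

Definition opnorm (A : 'M[K]_d) : R :=
  sup [set enorm (A *m x) | x in [set x : 'cV[K]_d | enorm x <= 1]].

Definition orthonormal_basis (S : set 'cV[K]_d) (I : pred 'I_d)
    (eta : 'I_d -> 'cV[K]_d) : Prop :=
  [/\ forall i, I i -> S (eta i),
      forall i j, I i -> I j -> inner (eta i) (eta j) = (i == j)%:R
    & forall v, S v ->
        exists c : 'I_d -> K, v = \sum_(i < d | I i) c i *: eta i].

(* Matrices act on column vectors, whereas the row space notions of mxalgebra
   (such as kermx) refer to the action on row vectors. *)
Definition im_mx (A : 'M[K]_d) : set 'cV[K]_d := range (fun x => A *m x).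
Definition ker_mx (A : 'M[K]_d) : set 'cV[K]_d := [set x | A *m x = 0].

End Euclidean.

Section OpnormTopology.
Variables (R : realType) (k : scalar_kind).
Local Notation K := (scalar_field R k).

Lemma modulus_norm (x y : K) : (modulus x < modulus y) = (`|x| < `|y|).
Proof.
case: k x y => x y //=.
have E z : `|z| = (ComplexField.Normc.normc z)%:C%C by [].
by rewrite !E ltcR.
Qed.

Lemma modulus_ge0 (x : K) : 0 <= modulus x.
Proof.
case: k x => x /=; first exact: normr_ge0.
by case: x => a b; exact: sqrtr_ge0.
Qed.

Lemma modulus0 : modulus (0 : K) = 0.
Proof.
by case: k => /=; [exact: normr0 | exact: ComplexField.Normc.normc0].
Qed.

Lemma modulusM (x y : K) : modulus (x * y) = modulus x * modulus y.
Proof.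
by case: k x y => x y /=; [exact: normrM | exact: ComplexField.Normc.normcM].
Qed.

Lemma le_modulusD (x y : K) : modulus (x + y) <= modulus x + modulus y.
Proof.
case: k x y => x y /=; first exact: ler_normD.
exact: le_normcD.
Qed.

Lemma modulus_sum I (r : seq I) (F : I -> K) :
  modulus (\sum_(i <- r) F i) <= \sum_(i <- r) modulus (F i).
Proof.
elim/big_rec2: _ => [|i y x _ h]; first by rewrite modulus0.
by apply: le_trans (le_modulusD _ _) _; rewrite lerD2l.
Qed.

Lemma nbhs_modulusP (x : K) (A : set K) :
  nbhs x A <-> exists2 e : R, 0 < e & forall y, modulus (y - x) < e -> A y.
Proof.
have lift (e : R) : exists2 c : K, `|c| = c & modulus c = `|e|.
  case: k => /=; first by exists `|e|; rewrite ?normr_id.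
  have nE : ComplexField.Normc.normc (`|e|%:C)%C = `|e|.
    by rewrite /= expr0n addr0 sqrtr_sqr normr_id.
  exists (`|e|%:C)%C; last exact: nE.
  have -> : `|(`|e|%:C)%C| = (ComplexField.Normc.normc (`|e|%:C)%C)%:C%C by [].
  by rewrite nE.
split.
  move=> /nbhs_ballP[c /= c0 cA]; exists (modulus c).
    rewrite lt_neqAle modulus_ge0 andbT eq_sym; apply/negP => /eqP h.
    have : modulus (0 : K) < modulus c.
      by rewrite modulus_norm normr0 normr_gt0 gt_eqF.
    by rewrite h modulus0 ltxx.
  move=> y; rewrite modulus_norm (gtr0_norm c0) => h; apply: cA.
  by rewrite -ball_normE /= distrC.
move=> [e e0 eA]; have [c c1 c2] := lift e.
rewrite gtr0_norm // in c2.
apply/nbhs_ballP; exists c => /=.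
  rewrite -c1 normr_gt0; apply/eqP => h.
  by move: e0; rewrite -c2 h modulus0 ltxx.
move=> y; rewrite -ball_normE /= => h; apply: eA.
by rewrite -c2 modulus_norm c1 distrC.
Qed.

Variable d : nat.

Lemma enorm_le_sum (x : 'cV[K]_d) : enorm x <= \sum_i modulus (x i ord0).
Proof.
have s0 : 0 <= \sum_i modulus (x i ord0).
  by apply: sumr_ge0 => i _; exact: modulus_ge0.
rewrite /enorm -(ger0_norm s0) -sqrtr_sqr ler_sqrt ?sqr_ge0 //.
suff [] : 0 <= \sum_i modulus (x i ord0) /\
  \sum_i modulus (x i ord0) ^+ 2 <= (\sum_i modulus (x i ord0)) ^+ 2 by [].
elim/big_rec2: _ => [|i a b _ [a0 ab]]; first by rewrite expr0n.
have m0 := modulus_ge0 (x i ord0).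
split; first exact: addr_ge0.
rewrite sqrrD -addrA lerD2l; apply: le_trans ab _.
by rewrite lerDr mulrn_wge0 // mulr_ge0.
Qed.

Lemma modulus_le_enorm (x : 'cV[K]_d) i : modulus (x i ord0) <= enorm x.
Proof.
rewrite -(ger0_norm (modulus_ge0 _)) -sqrtr_sqr /enorm.
rewrite ler_sqrt ?sumr_ge0 // => [|j _]; last exact: sqr_ge0.
by rewrite (bigD1 i) //= lerDl sumr_ge0 // => j _; exact: sqr_ge0.
Qed.

Lemma enorm_mul_le (A : 'M[K]_d) (x : 'cV[K]_d) :
  enorm x <= 1 -> enorm (A *m x) <= \sum_i \sum_j modulus (A i j).
Proof.
move=> x1; apply: le_trans (enorm_le_sum _) _.
apply: ler_sum => i _; rewrite mxE; apply: le_trans (modulus_sum _ _) _.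
apply: ler_sum => j _; rewrite modulusM.
by rewrite ler_piMr ?modulus_ge0 // (le_trans (modulus_le_enorm x j)).
Qed.

Lemma enorm0 : enorm (0 : 'cV[K]_d) = 0.
Proof.
by rewrite /enorm big1 ?sqrtr0 // => i _; rewrite mxE modulus0 expr0n.
Qed.

Lemma has_sup_opnorm (A : 'M[K]_d) :
  has_sup [set enorm (A *m x) | x in [set x : 'cV[K]_d | enorm x <= 1]].
Proof.
split; first by exists (enorm (A *m 0)), 0 => //=; rewrite enorm0 ler01.
exists (\sum_i \sum_j modulus (A i j)) => _ [x x1 <-]; exact: enorm_mul_le.
Qed.

Lemma opnorm_le_sum (A : 'M[K]_d) : opnorm A <= \sum_i \sum_j modulus (A i j).
Proof.
apply: ge_sup; first by case: (has_sup_opnorm A).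
by move=> _ [x x1 <-]; exact: enorm_mul_le.
Qed.

Lemma modulus_le_opnorm (A : 'M[K]_d) i j : modulus (A i j) <= opnorm A.
Proof.
have -> : A i j = (A *m delta_mx j ord0 : 'cV[K]_d) i ord0.
  by rewrite -colE mxE.
apply: le_trans (modulus_le_enorm _ _) _.
apply: ub_le_sup; first by case: (has_sup_opnorm A).
exists (delta_mx j ord0) => //=.
have m1 : modulus (1 : K) = 1.
  by case: k => /=; [exact: normr1 | exact: ComplexField.Normc.normc1].
apply: le_trans (enorm_le_sum _) _; rewrite (bigD1 j) //=.
rewrite mxE !eqxx m1 big1 ?addr0 //.
by move=> l lj; rewrite mxE (negPf lj) modulus0.
Qed.

(* The canonical (entrywise) topology on square matrices is the one given
   by the operator norm. *)
Lemma nbhs_opnormP (A : 'M[K]_d) (S : set 'M[K]_d) :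
  nbhs A S <-> exists2 e : R, 0 < e & forall B, opnorm (B - A) < e -> S B.
Proof.
split.
  move=> [P AP PS].
  have /choice[e eP] : forall ij : 'I_d * 'I_d, exists e : R, 0 < e /\
      forall y, modulus (y - A ij.1 ij.2) < e -> P ij.1 ij.2 y.
    by move=> [i j]; have /nbhs_modulusP[e e0 eP] := AP i j; exists e.
  exists (\big[Num.min/1]_ij e ij).
    by elim/big_rec: _ => // ij x _ x0; rewrite lt_min x0 (eP ij).1.
  move=> B AB; apply: PS => i j; apply: (eP (i, j)).2 => /=.
  have -> : B i j - A i j = (B - A) i j by rewrite !mxE.
  apply: le_lt_trans (modulus_le_opnorm _ _ _) _; apply: lt_le_trans AB _.
  exact: (bigmin_le _ (i, j) e).
move=> [e e0 eS].
pose c := e / (d * d).+1%:R.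
exists (fun i j => [set y | modulus (y - A i j) < c]).
  by move=> i j; apply/nbhs_modulusP; exists c => //; rewrite divr_gt0.
move=> B AB; apply: eS; apply: le_lt_trans (opnorm_le_sum _) _.
apply: (@le_lt_trans _ _ (\sum_(i < d) \sum_(j < d) c)).
  apply: ler_sum => i _; apply: ler_sum => j _; rewrite !mxE ltW //.
  exact: AB.
rewrite !sumr_const !card_ord -mulrnA -mulr_natr /c mulrAC ltr_pdivrMr //.
by rewrite ltr_pM2l // ltr_nat.
Qed.

End OpnormTopology.

Section Cotranslation.
Variables (R : realType) (k : scalar_kind) (d : nat) (G : topGroupType).
Local Notation K := (scalar_field R k).
Implicit Types (T P : G -> 'M[K]_d) (W V : G * G -> 'M[K]_d).

(* Stated for fixed G, K and d: quantified over all groups it fails, because of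
   nontrivial vector bundles, e.g. over the circle. *)
Definition continuous_frame_hypothesis : Prop :=
  forall P, continuous P -> (forall g, P g *m P g = P g) ->
  exists (eta : G -> 'I_d -> 'cV[K]_d) (T : G -> 'M[K]_d),
    [/\ forall g, orthonormal_basis (im_mx (P g))
          [pred i : 'I_d | (i < \rank (P g))%N] (eta g),
        forall g, orthonormal_basis (ker_mx (P g))
          [pred i : 'I_d | (\rank (P g) <= i)%N] (eta g),
        forall g, T g \in unitmx,
        forall g (i : 'I_d), T g *m delta_mx i ord0 = eta g i
      & continuous T].

Definition partial_cotranslation W : Prop :=
  forall g h l : G, W (g, (l * h)%g) = W ((h * g)%g, l) *m W (g, h).

Definition units_projector W : G -> 'M[K]_d := fun g => W (g, 1%g).

Definition rank_cotranslation W : nat := \rank (W (1%g, 1%g)).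

(* The choice of the base point is immaterial. *)
Lemma rank_cotranslationE W : partial_cotranslation W ->
  forall g h, \rank (W (g, h)) = rank_cotranslation W.
Proof.
move=> HW.
have leh g h l : (\rank (W (g, h)) <= \rank (W (g, l)))%N.
  by rewrite -[in X in (X <= _)%N](mulgVK l h) HW; exact: mxrankM_maxr.
have leg g h g' h' : (\rank (W (g, h)) <= \rank (W (g', h')))%N.
  apply: leq_trans (leh g h (h' * (g' * g^-1))%g) _.
  by rewrite HW mulgVK; exact: mxrankM_maxl.
by move=> g h; apply/eqP; rewrite eqn_leq !leg.
Qed.

Definition constant_orthogonal_projector W : Prop :=
  forall g, units_projector W g = pid_mx (rank_cotranslation W).

Definition conjugation T W V : Prop :=
  (forall g, T g \in unitmx) /\
  (forall g h : G, T (h * g)%g *m V (g, h) = W (g, h) *m T g).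

Definition continuous_conjugation T W V : Prop :=
  [/\ conjugation T W V, continuous T, continuous W & continuous V].

Definition sup_opnorm2 (A B : G -> 'M[K]_d) : \bar R :=
  ereal_sup (range (fun g => (opnorm (A g))%:E) `|`
             range (fun g => (opnorm (B g))%:E)).

Definition bounded_conjugation T W V : Prop :=
  conjugation T W V /\ (sup_opnorm2 T (fun g => invmx (T g)) < +oo)%E.

End Cotranslation.

(* Main.v *)
(* The projector P g = W (g, e) is continuous, idempotent and of constant rank,
   so the frame hypothesis gives T with P g *m T g = T g *m pid_mx r; the
   partial cotranslation is V (g, h) = T (hg)^-1 W (g, h) T g.  The columns of T g
   are unit vectors, and T g^-1 has entries <P e_j, eta_i> or <(1 - P) e_j, eta_i>,
   which shows both its continuity and its boundedness when P and 1 - P are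
   bounded: the same T settles the two assertions. *)
Require Import Defs.
From HB Require Import structures.
From mathcomp Require Import all_boot all_order all_algebra.
From mathcomp Require Import complex.
From mathcomp Require Import all_classical all_reals all_analysis.
Import Order.TTheory GRing.Theory Num.Theory.
Import numFieldNormedType.Exports.

Set Implicit Arguments.
Unset Strict Implicit.
Unset Printing Implicit Defensive.

Local Open Scope classical_set_scope.
Local Open Scope ring_scope.

(** * Conjugation and unit vectors over both scalar fields *)

Section Scalars.
Context {R : realType} {k : scalar_kind}.
Local Notation K := (scalar_field R k).

Lemma conj_scalarB (x y : K) :
  conj_scalar (x - y) = conj_scalar x - conj_scalar y.
Proof. by case: k x y => x y //=; exact: rmorphB. Qed.

Lemma modulus_conj (x : K) : modulus (conj_scalar x) = modulus x.
Proof. by case: k x => x //=; case: x => a b /=; rewrite sqrrN. Qed.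

(** Conjugation preserves distances measured by [modulus], so the same radius serves. *)
Lemma conj_scalar_continuous : continuous (@conj_scalar R k).
Proof.
move=> x A /nbhs_modulusP[e e0 eA]; apply/nbhs_modulusP; exists e => // y xy.
by apply: eA; rewrite -conj_scalarB modulus_conj.
Qed.

Lemma enorm_unit d (x : 'cV[K]_d) : inner x x = 1 -> enorm x = 1.
Proof.
rewrite /inner /enorm; case: k x => x /= h.
  rewrite (_ : \sum_i _ = 1) ?sqrtr1 // -[RHS]h.
  by apply: eq_bigr => i _; rewrite real_normK ?num_real.
(* In the complex case [inner x x = 1] is an equation in [R[i]]; it descends to [R] because the
   embedding of [R] is injective. *)
have hE (z : R[i]) : z * conjc z = (ComplexField.Normc.normc z ^+ 2)%:C%C.
  by rewrite -normCK rmorphXn.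
have : (\sum_i ComplexField.Normc.normc (x i ord0) ^+ 2)%:C%C = 1%:C%C :> R[i].
  by rewrite rmorph_sum -[RHS]h; apply: eq_bigr => i _; rewrite hE.
by move=> /complexI ->; rewrite sqrtr1.
Qed.

End Scalars.

(** * Entrywise continuity of matrix-valued maps *)

Section MatrixContinuity.
Context {K : numFieldType} {X : topologicalType}.

(** Neighbourhoods of a matrix contain entrywise boxes: a box constraining one entry gives one
    direction, a finite intersection over all entries the other. *)
Lemma continuous_mxP m n (F : X -> 'M[K]_(m, n)) :
  continuous F <-> forall i j, continuous (fun x => F x i j).
Proof.
split=> [Fc i j x A xA|Fc x A [P xP PA]].
  apply: (Fc x [set M | A (M i j)]).
  exists (fun i' j' => if (i', j') == (i, j) then A else setT).
    by move=> i' j'; case: eqP => [[-> ->]//|_]; exact: filterT.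
  by move=> M /(_ i j); rewrite eqxx.
have : \forall y \near x, forall ij : 'I_m * 'I_n, P ij.1 ij.2 (F y ij.1 ij.2).
  by apply: filter_forall => -[i j]; exact: Fc (xP i j).
by apply: filterS => y Py; apply: PA => i j; exact: (Py (i, j)).
Qed.

Lemma continuous_mulmx m n p (F : X -> 'M[K]_(m, n)) (H : X -> 'M[K]_(n, p)) :
  continuous F -> continuous H -> continuous (fun x => F x *m H x).
Proof.
move=> /continuous_mxP Fc /continuous_mxP Hc; apply/continuous_mxP => i j.
rewrite (_ : (fun _ => _) = fun x => \sum_l F x i l * H x l j); last first.
  by apply/funext => x; rewrite mxE.
apply: continuous_big => [|l _ x]; first exact: add_continuous.
by apply: cvgM; [exact: Fc|exact: Hc].
Qed.

End MatrixContinuity.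

(** * Frames adapted to an idempotent, and their inverses *)

Section FrameInverse.
Context {R : realType} {k : scalar_kind} {d : nat}.
Local Notation K := (scalar_field R k).
Implicit Types P T : 'M[K]_d.

Definition adjoint_mx T : 'M[K]_d := (map_mx (@conj_scalar R k) T)^T.

(* The rows of the inverse of a frame adapted to [P] are the coordinate
   functionals [x |-> <P x, eta i>] on the image of [P], and
   [x |-> <(1 - P) x, eta i>] on its kernel. *)
Definition frame_inv P T : 'M[K]_d :=
  \matrix_(i, j) (adjoint_mx T *m (if (i < \rank P)%N then P else 1%:M - P)) i j.

Definition adapted_frame P T :=
  orthonormal_basis (im_mx P) [pred i : 'I_d | (i < \rank P)%N]
    (fun i => col i T) /\
  orthonormal_basis (ker_mx P) [pred i : 'I_d | (\rank P <= i)%N]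
    (fun i => col i T).

Lemma mul_pid_mxE m n p (A : 'M[K]_(m, n)) i (j : 'I_n) :
  (A *m (pid_mx p : 'M[K]_n)) i j = A i j * (j < p)%N%:R.
Proof.
rewrite mxE (bigD1 j) //= big1 ?addr0 ?mxE ?eqxx // => l.
by rewrite !mxE -val_eqE => /negPf ->; rewrite mulr0.
Qed.

(** Column by column: [P] fixes the vectors of its image and kills those of its kernel. *)
Lemma frame_mulmx P T : P *m P = P -> adapted_frame P T ->
  P *m T = T *m pid_mx (\rank P).
Proof.
move=> PP [[imT _ _] [kerT _ _]].
apply/matrixP => i j; transitivity ((P *m col j T) i ord0).
  by rewrite !mxE; apply: eq_bigr => l _; rewrite !mxE.
rewrite mul_pid_mxE; have [jP|jP] := ltnP j (\rank P).
  by have [x _ xE] := imT j jP; rewrite -xE mulmxA PP xE mxE mulr1.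
by rewrite (kerT j jP) mxE mulr0.
Qed.

(** The indices are swapped because [inner] conjugates its second argument. *)
Lemma adjoint_mx_mul T i j :
  (adjoint_mx T *m T) i j = inner (col j T) (col i T).
Proof. by rewrite mxE; apply: eq_bigr => l _; rewrite !mxE mulrC. Qed.

(** Image and kernel of [P] need not be orthogonal, so the adjoint of [T] alone is no inverse.
    Inserting [P] or [1%:M - P] kills the cross terms, and orthonormality inside each block gives
    the rest. *)
Lemma frame_invK P T : P *m P = P -> adapted_frame P T ->
  frame_inv P T *m T = 1%:M.
Proof.
move=> PP fT; have PT := frame_mulmx PP fT.
have [[_ oim _] [_ oker _]] := fT.
apply/matrixP => i j.
transitivity
  ((adjoint_mx T *m (if (i < \rank P)%N then P else 1%:M - P) *m T) i j).
  by rewrite mxE [RHS]mxE; apply: eq_bigr => l _; rewrite mxE.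
rewrite -mulmxA [RHS]mxE.
have [iP|iP] := ltnP i (\rank P).
  rewrite PT mulmxA mul_pid_mxE adjoint_mx_mul.
  have [jP|jP] := ltnP j (\rank P); first by rewrite mulr1 oim // eq_sym.
  by rewrite mulr0; case: eqP => // ij; move: iP; rewrite ij ltnNge jP.
have -> : adjoint_mx T *m ((1%:M - P) *m T) =
    adjoint_mx T *m T - adjoint_mx T *m T *m pid_mx (\rank P).
  by rewrite mulmxBl mul1mx PT mulmxBr mulmxA.
rewrite mxE [X in _ + X]mxE mul_pid_mxE adjoint_mx_mul.
have [jP|jP] := ltnP j (\rank P); last by rewrite mulr0 subr0 oker // eq_sym.
by rewrite mulr1 subrr; case: eqP => // ij; move: jP; rewrite -ij ltnNge iP.
Qed.

Lemma modulus_adapted_frame P T i j :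
  adapted_frame P T -> modulus (T i j) <= 1.
Proof.
move=> [[_ oim _] [_ oker _]].
have -> : T i j = col j T i ord0 by rewrite mxE.
apply: le_trans (modulus_le_enorm _ _) _; rewrite enorm_unit //.
have [jP|jP] := ltnP j (\rank P); first by rewrite oim ?eqxx.
by rewrite oker ?eqxx.
Qed.

Lemma ler_sum_const n (F : 'I_n -> R) (c : R) :
  (forall i, F i <= c) -> \sum_i F i <= c *+ n.
Proof.
move=> Fc; rewrite -[n in c *+ n]card_ord -sumr_const.
by apply: ler_sum => i _; exact: Fc.
Qed.

Lemma opnorm_le_entries (A : 'M[K]_d) (c : R) :
  (forall i j, modulus (A i j) <= c) -> opnorm A <= c *+ (d * d).
Proof.
move=> Ac; apply: le_trans (opnorm_le_sum A) _.
by rewrite mulrnA; apply: ler_sum_const => i; exact: ler_sum_const.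
Qed.

(** Each entry is a sum of [d] products of a factor of modulus at most 1 and one of modulus at most
    [c]. *)
Lemma modulus_frame_inv P T (c : R) i j : adapted_frame P T ->
  opnorm P <= c -> opnorm (1%:M - P) <= c ->
  modulus (frame_inv P T i j) <= c *+ d.
Proof.
move=> fT Pc Qc; rewrite mxE mxE; apply: le_trans (modulus_sum _ _) _.
apply: ler_sum_const => l.
rewrite modulusM !mxE modulus_conj -[c]mul1r.
apply: ler_pM (modulus_ge0 _) (modulus_ge0 _) (modulus_adapted_frame _ _ fT) _.
by case: ifP => _; apply: le_trans (modulus_le_opnorm _ _ _) _.
Qed.

(** Constant rank makes the case distinction in [frame_inv] independent of the point, so each entry
    follows a single branch. *)
Lemma frame_inv_continuous (X : topologicalType) (P T : X -> 'M[K]_d) r :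
  continuous P -> (forall x, \rank (P x) = r) -> continuous T ->
  continuous (fun x => frame_inv (P x) (T x)).
Proof.
move=> Pc Pr Tc; apply/continuous_mxP => i j.
pose Q x := if (i < r)%N then P x else 1%:M - P x.
have Qc : continuous Q.
  rewrite /Q; case: (i < r)%N => //; apply/continuous_mxP => l m.
  rewrite (_ : (fun _ => _) = fun x => (1%:M : 'M[K]_d) l m - P x l m); last first.
    by apply/funext => x; rewrite !mxE.
  by move=> x; apply: cvgB; [exact: cvg_cst|move/continuous_mxP: Pc; apply].
rewrite (_ : (fun _ => _) = fun x => (adjoint_mx (T x) *m Q x) i j); last first.
  by apply/funext => x; rewrite mxE Pr.
apply: (continuous_mxP _).1; apply: continuous_mulmx => //.
apply/continuous_mxP => l m.
rewrite (_ : (fun _ => _) = fun x => conj_scalar (T x m l)); last first.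
  by apply/funext => x; rewrite !mxE.
move=> x; apply: continuous_comp; last exact: conj_scalar_continuous.
by move/continuous_mxP: Tc; apply.
Qed.

End FrameInverse.

Theorem corollary5p21 (R : realType) (k : scalar_kind) (d : nat)
    (G : topGroupType)
    (G_locally_compact : locally_compact [set: G])
    (G_hausdorff : hausdorff_space G)
    (frame_hypothesis : continuous_frame_hypothesis R k d G)
    (W : G * G -> 'M[scalar_field R k]_d)
    (W_cotranslation : partial_cotranslation W)
    (W_continuous : continuous W) :
  (exists (V : G * G -> 'M[scalar_field R k]_d)
          (T : G -> 'M[scalar_field R k]_d),
     [/\ partial_cotranslation V,
         constant_orthogonal_projector V
       & continuous_conjugation T W V]) /\
  ((exists M : R, 1 <= M /\
      (sup_opnorm2 (units_projector W)
         (fun g => 1%:M - units_projector W g)%R < M%:E)%E) ->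
   exists (V : G * G -> 'M[scalar_field R k]_d)
          (T : G -> 'M[scalar_field R k]_d),
     [/\ partial_cotranslation V,
         constant_orthogonal_projector V,
         continuous_conjugation T W V
       & bounded_conjugation T W V]).
Proof.
pose P := units_projector W.
(* The cotranslation identity with both increments equal to the unit. *)
have Pidem g : P g *m P g = P g.
  by have := W_cotranslation g 1%g 1%g; rewrite !mul1g.
have Pc : continuous P.
  move=> g; apply: (@continuous_comp _ _ _ (fun g : G => (g, 1%g : G)) W).
    by apply: cvg_pair; [exact: cvg_id|exact: cvg_cst].
  exact: W_continuous.
have Prank g : \rank (P g) = rank_cotranslation W.
  exact: rank_cotranslationE.
have [eta [T [imT kerT Tunit Teta Tc]]] := frame_hypothesis P Pc Pidem.
have fT g : adapted_frame (P g) (T g).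
  have etaE : eta g = (fun i => col i (T g)).
    by apply/funext => i; rewrite colE Teta.
  by rewrite /adapted_frame -etaE.
pose D g := frame_inv (P g) (T g).
have DT g : D g *m T g = 1%:M by exact: frame_invK.
have TD g : T g *m D g = 1%:M by exact: mulmx1C.
have Dc : continuous D by exact: frame_inv_continuous Pc Prank Tc.
pose V (p : G * G) := D (p.2 * p.1)%g *m W p *m T p.1.
have Vcot : partial_cotranslation V.
  move=> g h l; rewrite /V /= W_cotranslation -!mulgA.
  (* The inner factors [T (h * g)] and [D (h * g)] cancel. *)
  by rewrite -[RHS]mulmxA !mulmxA -(mulmxA _ (T _) (D _)) TD mulmx1.
have Vunit g : units_projector V g = pid_mx (rank_cotranslation W).
  rewrite /units_projector /V /= mul1g -mulmxA -/(P g).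
  by rewrite (frame_mulmx (Pidem g) (fT g)) mulmxA DT mul1mx Prank.
have Vproj : constant_orthogonal_projector V.
  (* The definition refers to the rank of [V]; it equals that of [W], since the rank of [W] is at
     most [d]. *)
  move=> g; rewrite Vunit /rank_cotranslation -/(units_projector V 1%g) Vunit.
  by rewrite -/(rank_cotranslation W) rank_pid_mx // -(Prank 1%g) rank_leq_row.
have Vconj : conjugation T W V.
  by split=> // g h; rewrite /V /= !mulmxA TD mul1mx.
have Vc : continuous V.
  have c1 : continuous (fun p : G * G => p.1) by move=> p; exact: cvg_fst.
  have c2 : continuous (fun p : G * G => p.2) by move=> p; exact: cvg_snd.
  apply: continuous_mulmx => [|p]; last first.
    by apply: (@continuous_comp _ _ _ fst T); [exact: c1|exact: Tc].
  apply: continuous_mulmx => // p.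
  apply: (@continuous_comp _ _ _ (fun p : G * G => (p.2 * p.1)%g) D);
    last exact: Dc.
  apply: (@continuous_comp _ _ _ (fun p : G * G => (p.2, p.1))
    (fun p : G * G => (p.1 * p.2)%g)); last exact: mulg_continuous.
  by apply: cvg_pair; [exact: c2|exact: c1].
have Vcc : continuous_conjugation T W V by [].
split=> [|[M [M1 supM]]]; first by exists V, T.
exists V, T; split=> //; split=> //.
have PM g : opnorm (P g) <= M.
  rewrite -lee_fin; apply: le_trans (ltW supM); apply: ereal_sup_ubound.
  by left; exists g.
have QM g : opnorm (1%:M - P g) <= M.
  rewrite -lee_fin; apply: le_trans (ltW supM); apply: ereal_sup_ubound.
  by right; exists g.
(* The first term bounds [T], with entries of modulus at most 1; the second bounds [D], with entries
   of modulus at most [M *+ d]. *)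
pose C : R := Num.max (1 *+ (d * d)) (M *+ d *+ (d * d)).
apply: (@le_lt_trans _ _ C%:E); last exact: ltry.
apply: ge_ereal_sup => _ [] [g _ <-]; rewrite lee_fin le_max.
  apply/orP; left; apply: opnorm_le_entries => i j.
  exact: modulus_adapted_frame (fT g).
have -> : invmx (T g) = D g by rewrite -[RHS](mulmxK (Tunit g)) DT mul1mx.
apply/orP; right; apply: opnorm_le_entries => i j.
exact: modulus_frame_inv.
Qed.
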